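(* Consider an $N$-node networked system under cycle topology, i.e. $\beta_{i+1,i}\ne0$ for $1\le i\le N-1$, $\beta_{1N}\ne0$, and all other $\beta_{ij}$ (in particular all $\beta_{ii}$) are $0$. For $1\le i\le N$ let $\sigma(A_i)=\{\mu_i^1,\dots,\mu_i^{q_i}\}$ be the set of distinct eigenvalues of $A_i$, let $\gamma_{ij}$ be the geometric multiplicity of $\mu_i^j$ as an eigenvalue of $A_i$, and let $\zeta_{ij}^k\in\mathbb{C}^{1\times n_i}$, $1\le k\le\gamma_{ij}$, be (linearly independent) left eigenvectors of $A_i$ corresponding to $\mu_i^j$. Suppose $H_{j+1}C_j=0$ for $j=1,\dots,N-1$, and $\zeta_{1j}^kH_1C_N=0$ for all $1\le j\le q_1$ and $1\le k\le\gamma_{1j}$. Then the networked system $\dot X=\mathcal{A}X+\mathcal{B}U$ is controllable if and only if both of the following hold: (i) $(A_i,B_i)$ is a controllable pair for every $1\le i\le N$; (ii) each node is under external control, i.e. $\delta_i\neq0$ for all $i$.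
   Context: A networked system with $N$ nodes is given by data $A_i\in\mathbb{R}^{n_i\times n_i}$, $B_i\in\mathbb{R}^{n_i\times p_i}$, $C_i\in\mathbb{R}^{m\times n_i}$, $H_i\in\mathbb{R}^{n_i\times m}$ (inner-coupling matrices), $\delta_i\in\{0,1\}$ for $1\le i\le N$ ($\delta_i=1$ if node $i$ has an external control input, $0$ otherwise), and real numbers $\beta_{ij}$, $1\le i,j\le N$, where $\beta_{ij}\ne0$ if and only if there is an edge from node $j$ to node $i$. The node dynamics are $\dot x_i=A_ix_i+\sum_{j=1}^N\beta_{ij}H_iC_jx_j+\delta_iB_iu_i$, $y_i=C_ix_i$. In compact form the networked system is $\dot X=\mathcal{A}X+\mathcal{B}U$, where $\mathcal{A}=\mathrm{blockdiag}\{A_1,\dots,A_N\}+(\beta_{ij}H_iC_j)_{i,j=1}^N$ and $\mathcal{B}=\mathrm{blockdiag}\{\delta_1B_1,\dots,\delta_NB_N\}$. A linear system $\dot x=Ax+Bu$ with $A\in\mathbb{R}^{n\times n}$ (equivalently the pair $(A,B)$) is controllable if for any $x_0,x_f\in\mathbb{R}^n$ and any final time $t_f>t_0$ there is an admissible control $u$ on $[t_0,t_f]$ steering $x(t_0)=x_0$ to $x(t_f)=x_f$; equivalently $\mathrm{rank}[B\,|\,AB\,|\cdots|\,A^{n-1}B]=n$. $\sigma(M)$ denotes the set of (complex) eigenvalues of $M$. A left eigenvector of a square matrix $M$ for the eigenvalue $\mu$ is a nonzero row vector $v$ with $vM=\mu v$. *)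

(* Defs.v *)
From HB Require Import structures.
From mathcomp Require Import all_boot all_order all_algebra.
From mathcomp Require Import complex.
From mathcomp Require Import all_classical all_reals all_analysis.

Set Implicit Arguments.
Unset Strict Implicit.
Unset Printing Implicit Defensive.

Import Order.TTheory GRing.Theory Num.Theory.
Import numFieldNormedType.Exports.

Local Open Scope classical_set_scope.
Local Open Scope ring_scope.

Section Controllability.
Variables (R : realType) (n p : nat).

(* Admissible controls are the Lebesgue-integrable ones. *)
Definition admissible (t0 tf : R) (u : R -> 'cV[R]_p) : Prop :=
  forall k : 'I_p,
    lebesgue_measure.-integrable `[t0, tf] (EFin \o (fun s => u s k ord0)).

(* x' = A x + B u on [t0, tf] in the sense of Caratheodory: for merely
   integrable u the equation is understood in integral form, and x is a
   continuous function. *)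
Definition trajectory (A : 'M[R]_n) (B : 'M[R]_(n, p)) (t0 tf : R)
    (u : R -> 'cV[R]_p) (x : R -> 'cV[R]_n) : Prop :=
  forall k : 'I_n,
    {within `[t0, tf], continuous (fun s => x s k ord0)} /\
    forall t : R, t0 <= t <= tf ->
      x t k ord0 = x t0 k ord0
        + \int[lebesgue_measure]_(s in `[t0, t])
            ((A *m x s + B *m u s) k ord0).

Definition controllable (A : 'M[R]_n) (B : 'M[R]_(n, p)) : Prop :=
  forall (t0 tf : R) (x0 xf : 'cV[R]_n), t0 < tf ->
    exists (u : R -> 'cV[R]_p) (x : R -> 'cV[R]_n),
      [/\ admissible t0 tf u, trajectory A B t0 tf u x, x t0 = x0 & x tf = xf].

End Controllability.

Section Spectrum.
Variables (R : realType) (n : nat).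

Definition complexify (A : 'M[R]_n) : 'M[complex R]_n :=
  map_mx (real_complex R) A.

(* eigenspace M a is the space of row vectors v with v M = a v, whose dimension
   is that of the column eigenspace. *)
Definition geometric_multiplicity (M : 'M[complex R]_n) (a : complex R) : nat :=
  \rank (eigenspace M a).

Definition left_eigenvector (M : 'M[complex R]_n) (a : complex R)
    (v : 'rV[complex R]_n) : Prop :=
  v != 0 /\ v *m M = a *: v.

End Spectrum.

Section Network.
Variables (R : realType) (N m : nat) (n p : 'I_N -> nat).

Definition network_state (A : forall i, 'M[R]_(n i))
    (C : forall i, 'M[R]_(m, n i)) (H : forall i, 'M[R]_(n i, m))
    (beta : 'I_N -> 'I_N -> R) : 'M[R]_(\sum_i n i) :=
  (\mxdiag_i A i) + (\mxblock_(i, j) (beta i j *: (H i *m C j))).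

(* blockdiag of the rectangular blocks delta_i B_i, written as mxdiag is for
   square ones: conform_mx only casts the (i, i) block to size n i x p j, and
   j is i there. *)
Definition network_input (B : forall i, 'M[R]_(n i, p i))
    (delta : 'I_N -> bool) : 'M[R]_(\sum_i n i, \sum_i p i) :=
  \mxblock_(i, j) (if i == j then conform_mx 0 ((delta i)%:R *: B i) else 0).

(* beta i j is the weight of the edge from j to i; nodes are numbered from 0. *)
Definition cycle_topology (beta : 'I_N -> 'I_N -> R) : Prop :=
  forall i j : 'I_N,
    (beta i j != 0) =
    (val i == (val j).+1) || ((val i == 0%N) && (val j == N.-1)).

End Network.

(* Main.v *)
Require Import Defs.
From HB Require Import structures.
From mathcomp Require Import all_boot all_order all_algebra.
From mathcomp Require Import complex ring.
From mathcomp Require Import all_classical all_reals all_analysis.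

Set Implicit Arguments.
Unset Strict Implicit.
Unset Printing Implicit Defensive.

Import Order.TTheory GRing.Theory Num.Theory.
Import numFieldNormedType.Exports.

Local Open Scope ring_scope.

(** Why the theorem is true.  The coupling is invisible to left eigenvectors.
    Every product [H i *m C j] along the cycle vanishes except the one on the
    edge that closes it, from the last node to node 0, so the state matrix is
    the block diagonal of the [A i] plus a single block in row 0 and in the last
    column.  In an equation [v *m M = a *: v], with [v] cut into blocks [v i],
    column 0 (which is not the last one, as there are two nodes or more) says
    [v 0 *m A 0 = a *: v 0].  The given [zeta] span the eigenspaces of [A 0] and
    are killed by the extra block, hence so is [v 0], and the extra block drops
    out of the last column.  The equation is thus equivalent to
    [v i *m A i = a *: v i] for all [i]: this is [cycle_eigenvectors].

    The Hautus test ([controllableP]) says that a pair is controllable if and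
    only if no complex left eigenvector of the state matrix is killed by the
    input matrix.  The input matrix being block diagonal too, the network passes
    the test if and only if each pair [(A i, delta i *: B i)] does
    ([hautus_network]).  If [delta i] is false this fails, because [A i] has a
    complex eigenvector; if it is true, it is the controllability of
    [(A i, B i)].

    The Hautus test is proved for trajectories in integral form.  Necessity: the
    real and imaginary parts of an uncontrollable eigenvector are the rows of a
    real matrix [W] with [W *m A = F *m W] and [W *m B = 0], so [W *m x]
    solves an autonomous linear integral equation.  Started from 0 it stays at 0,
    by a contraction argument on a short interval ([integral_equation_eq0]), so
    [W] kills every reachable state.

    Sufficiency: by the Cayley-Hamilton theorem the Hautus condition gives a
    decomposition of the identity as a sum of terms [A ^+ k *m B *m M k]
    ([hautus_kalman]), and from there the steering is done by polynomials in
    time, without matrix exponentials or Gramians ([polynomial_control]): choose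
    a polynomial curve with the required end points that satisfies the
    uncontrolled equation to a high order at both ends, and repair the remaining
    defect by a correction that vanishes at both ends. *)

(** * The algebraic conditions *)

(** The existence of [M] is the usual rank condition: the columns of the
    [A ^+ k *m B] with [k < L] span the state space.  Explicit coefficients are
    what the construction of a control needs. *)
Definition kalman_decomposition (F : fieldType) n p (A : 'M[F]_n)
    (B : 'M[F]_(n, p)) (L : nat) : Prop :=
  exists M : 'I_L -> 'M[F]_(p, n), \sum_(k < L) A ^+ k *m B *m M k = 1%:M.

(** The eigenvector form of the Popov-Belevitch-Hautus test: [v] ranges over the
    left eigenvectors of [A] and zero. *)
Definition hautus (F : fieldType) n p (A : 'M[F]_n) (B : 'M[F]_(n, p)) : Prop :=
  forall (a : F) (v : 'rV[F]_n), v *m A = a *: v -> v *m B = 0 -> v = 0.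

(** * Steering with polynomials in time *)

Section PolynomialTrajectories.
Variable (R : realFieldType).

Local Notation lift := (map_mx (@polyC R)).
Local Notation D := (map_mx (@deriv R)).

Lemma deriv_lift_mul m n r (A : 'M[R]_(m, n)) (x : 'M[{poly R}]_(n, r)) :
  D (lift A *m x) = lift A *m D x.
Proof.
apply/matrixP => i j; rewrite !mxE raddf_sum; apply: eq_bigr => l _.
by rewrite /= !mxE derivM derivC mul0r add0r.
Qed.

Lemma deriv_mxZ m n (c : {poly R}) (x : 'M[{poly R}]_(m, n)) :
  D (c *: x) = c^`() *: x + c *: D x.
Proof. by apply/matrixP => i j; rewrite !mxE derivM. Qed.

(** With [q] a power of [('X - a%:P) * ('X - b%:P)] this says that [x] vanishes
    to a given order at both [a] and [b]. *)
Definition dvd_mx m n (q : {poly R}) (x : 'M[{poly R}]_(m, n)) : Prop :=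
  forall i j, q %| x i j.

Lemma dvd_mxD m n q (x y : 'M[{poly R}]_(m, n)) :
  dvd_mx q x -> dvd_mx q y -> dvd_mx q (x + y).
Proof. by move=> hx hy i j; rewrite mxE dvdp_add. Qed.

Lemma dvd_mxB m n q (x y : 'M[{poly R}]_(m, n)) :
  dvd_mx q x -> dvd_mx q y -> dvd_mx q (x - y).
Proof. by move=> hx hy i j; rewrite !mxE dvdp_sub. Qed.

Lemma dvd_mxM m n r q (x : 'M[{poly R}]_(m, n)) (y : 'M[{poly R}]_(n, r)) :
  dvd_mx q y -> dvd_mx q (x *m y).
Proof.
move=> hy i j; rewrite mxE; elim/big_ind: _ => [|a b|l _].
- exact: dvdp0.
- exact: dvdp_add.
- exact/dvdp_mull/hy.
Qed.

Lemma dvd_mxZ m n p q (c : {poly R}) (x : 'M[{poly R}]_(m, n)) :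
  p %| c -> dvd_mx q x -> dvd_mx (p * q) (c *: x).
Proof. by move=> hc hx i j; rewrite mxE dvdp_mul. Qed.

Lemma dvd_mx_trans m n p q (x : 'M[{poly R}]_(m, n)) :
  p %| q -> dvd_mx q x -> dvd_mx p x.
Proof. by move=> pq qx i j; exact: dvdp_trans pq (qx i j). Qed.

Lemma dvdp_deriv (q p : {poly R}) k : q ^+ k.+1 %| p -> q ^+ k %| p^`().
Proof.
case/dvdpP => s ->; rewrite derivM deriv_exp /= -mulrnAl.
by rewrite dvdp_add ?dvdp_mull// ?mulrnAr// exprS dvdp_mull.
Qed.

Section Disturbance.
Variables (n p : nat) (A : 'M[R]_n) (B : 'M[R]_(n, p)).

(** A disturbance entering through [A ^+ k *m B] can be moved to the input: the
    substitution [y = z - A ^+ k *m B *m g] trades [A ^+ k.+1 *m B *m g] for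
    [A ^+ k *m B *m g^`()], and when [k] is 0 the control [- g] cancels it.
    Each step costs one derivative of [g], which is why [g] must be divisible by
    [q ^+ k]; in return [y] vanishes at the roots of [q]. *)
Lemma disturbance_power (q : {poly R}) k (g : 'cV[{poly R}]_p) :
  dvd_mx (q ^+ k) g ->
  exists (y : 'cV[{poly R}]_n) (u : 'cV[{poly R}]_p),
    D y = lift A *m y + lift B *m u + lift (A ^+ k *m B) *m g /\ dvd_mx q y.
Proof.
elim: k g => [|k IH] g hg.
  exists 0, (- g); split; last by move=> i j; rewrite mxE dvdp0.
  rewrite mulmx0 add0r expr0 mul1mx mulmxN addNr.
  by apply/matrixP => i j; rewrite !mxE derivC.
have [|y [u [eqy hy]]] := IH (D g).
  by move=> i j; rewrite mxE; exact/dvdp_deriv.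
exists (y - lift (A ^+ k *m B) *m g), u; split.
  rewrite (map_mxB (@deriv R)) deriv_lift_mul eqy mulmxBr addrK.
  by rewrite mulmxA -map_mxM mulmxA exprS -mulmxE [RHS]addrAC subrK.
apply: dvd_mxB => //; apply: dvd_mxM => i j.
by apply: dvdp_trans (hg i j); rewrite exprS dvdp_mulr.
Qed.

(** The decomposition of the identity splits an arbitrary disturbance into
    pieces of the form treated above. *)
Lemma disturbance L (q : {poly R}) (f : 'cV[{poly R}]_n) :
  kalman_decomposition A B L -> dvd_mx (q ^+ L) f ->
  exists (y : 'cV[{poly R}]_n) (u : 'cV[{poly R}]_p),
    D y = lift A *m y + lift B *m u + f /\ dvd_mx q y.
Proof.
case=> M sumM hf.
have /fin_all_exists[y /fin_all_exists[u hyu]] : forall k : 'I_L,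
    exists (y : 'cV[{poly R}]_n) (u : 'cV[{poly R}]_p),
    D y = lift A *m y + lift B *m u + lift (A ^+ k *m B) *m (lift (M k) *m f) /\
    dvd_mx q y.
  move=> k; apply/disturbance_power/dvd_mxM.
  by apply: dvd_mx_trans hf; rewrite dvdp_exp2l// ltnW.
exists (\sum_k y k), (\sum_k u k); split; last first.
  elim/big_ind: _ => [|x z|k _].
  - by move=> i j; rewrite mxE dvdp0.
  - exact: dvd_mxD.
  - by case: (hyu k).
have fE : f = \sum_(k < L) lift (A ^+ k *m B) *m (lift (M k) *m f).
  under eq_bigr do rewrite mulmxA -map_mxM.
  by rewrite -mulmx_suml -raddf_sum /= sumM map_mx1 mul1mx.
rewrite [f in RHS]fE !mulmx_sumr -!big_split /=.
rewrite (raddf_sum (map_mx (@deriv R))).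
by apply: eq_bigr => k _; case: (hyu k).
Qed.

End Disturbance.

Variables (n : nat) (A : 'M[R]_n).

(** A solution of [D z = A z] up to order [L] at [a]: the Taylor polynomial at
    [a] of the exponential solution, whose defect is a single monomial. *)
Lemma jet L (a : R) (x : 'cV[R]_n) :
  exists z : 'cV[{poly R}]_n,
    dvd_mx (('X - a%:P) ^+ L) (D z - lift A *m z) /\
    map_mx (horner^~ a) z = x.
Proof.
pose e k : {poly R} := (k`!%:R^-1)%:P * ('X - a%:P) ^+ k.
have de k : (e k.+1)^`() = e k.
  rewrite /e derivM derivC mul0r add0r deriv_exp derivXsubC mul1r /=.
  rewrite mulrnAr -mulrnAl -polyCMn factS natrM invfM.
  by rewrite -(mulr_natr (_ * _)) mulrAC mulVf ?pnatr_eq0// mul1r.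
suff [z [dz zx]] : exists z : 'cV[{poly R}]_n,
    D z - lift A *m z = - (e L *: lift (A ^+ L.+1 *m x)) /\
    map_mx (horner^~ a) z = x.
  exists z; split=> // i j; rewrite dz !mxE dvdpNr.
  by rewrite /e mulrAC dvdp_mulIr.
(* The defect of the sum up to degree L is minus the derivative of the next
   term, so adding that term moves the defect one degree up. *)
elim: L => [|L [z [dz zx]]].
  exists (lift x); split; last by apply/matrixP => i j; rewrite !mxE hornerC.
  rewrite /e fact0 invr1 mul1r expr0 scale1r expr1 map_mxM -[RHS]sub0r.
  by congr (_ - _); apply/matrixP => i j; rewrite !mxE derivC.
exists (z + e L.+1 *: lift (A ^+ L.+1 *m x)); split.
  rewrite (map_mxD (@deriv R)) deriv_mxZ de mulmxDr opprD addrACA dz.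
  have -> : D (lift (A ^+ L.+1 *m x)) = 0.
    by apply/matrixP => i j; rewrite !mxE derivC.
  rewrite scaler0 addr0 addrA addNr add0r -scalemxAr -map_mxM mulmxA.
  by rewrite [A ^+ L.+2]exprS -mulmxE.
rewrite -[RHS]zx; apply/matrixP => i j.
rewrite !mxE /e hornerD !hornerM horner_exp !hornerE subrr.
by rewrite expr0n /= mulr0 mul0r addr0.
Qed.

(** Two such jets are glued with a partition of unity [ea + eb = 1] in which [ea]
    is flat at [a] and [eb] at [b]; it exists because the powers of ['X - a] and
    ['X - b] are coprime.  The defect of the glued curve combines the defects
    of the jets with [ea^`()], and all these terms are flat at both ends. *)
Lemma flat_interpolation L (a b : R) (x0 xf : 'cV[R]_n) : a != b ->
  exists z : 'cV[{poly R}]_n,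
    [/\ dvd_mx ((('X - a%:P) * ('X - b%:P)) ^+ L) (D z - lift A *m z),
        map_mx (horner^~ a) z = x0 & map_mx (horner^~ b) z = xf].
Proof.
move=> neq_ab.
have [z0 [dz0 z0a]] := jet L a x0; have [z1 [dz1 z1b]] := jet L b xf.
have /Bezout_eq1_coprimepP[[r s] /= rs1] :
    coprimep (('X - a%:P) ^+ L.+1) (('X - b%:P) ^+ L.+1).
  by rewrite coprimep_expl// coprimep_expr// coprimep_XsubC root_XsubC eq_sym.
set ea := _ * _ in rs1; set eb := s * _ in rs1.
have eaE : ea = 1 - eb by rewrite -rs1 addrK.
exists (eb *: z0 + ea *: z1).
have da : ('X - a%:P) ^+ L.+1 %| ea by rewrite dvdp_mulIr.
have db : ('X - b%:P) ^+ L.+1 %| eb by rewrite dvdp_mulIr.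
have da' : ('X - a%:P) ^+ L %| ea by apply: dvdp_trans da; rewrite dvdp_exp2l.
have db' : ('X - b%:P) ^+ L %| eb by apply: dvdp_trans db; rewrite dvdp_exp2l.
have dvdp_deriv_a : ('X - a%:P) ^+ L %| ea^`() by exact: dvdp_deriv.
have dvdp_deriv_b : ('X - b%:P) ^+ L %| ea^`().
  by rewrite eaE derivB derivC sub0r dvdpNr dvdp_deriv.
have eaa : ea.[a] = 0 by rewrite hornerM horner_exp !hornerE subrr expr0n mulr0.
have ebb : eb.[b] = 0 by rewrite hornerM horner_exp !hornerE subrr expr0n mulr0.
clearbody ea eb.
have eba : eb.[a] = 1.
  by have := congr1 (horner^~ a) rs1; rewrite hornerD hornerC eaa add0r.
have eab : ea.[b] = 1.
  by have := congr1 (horner^~ b) rs1; rewrite hornerD hornerC ebb addr0.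
split.
- have -> : D (eb *: z0 + ea *: z1) - lift A *m (eb *: z0 + ea *: z1) =
     eb *: (D z0 - lift A *m z0) + ea *: (D z1 - lift A *m z1)
     + ea^`() *: (z1 - z0).
    rewrite (map_mxD (@deriv R)) !deriv_mxZ mulmxDr -!scalemxAr !scalerBr.
    have -> : eb^`() = - ea^`() by rewrite eaE derivB derivC sub0r opprK.
    move: (lift A *m z0) (lift A *m z1) => az0 az1.
    by apply/matrixP => i j; rewrite !mxE; ring.
  rewrite exprMn; apply: dvd_mxD; first apply: dvd_mxD.
  + by rewrite mulrC; exact: dvd_mxZ.
  + exact: dvd_mxZ.
  + rewrite -[X in dvd_mx X _]mulr1.
    apply: dvd_mxZ; last by move=> i j; rewrite dvd1p.
    rewrite Gauss_dvdp ?dvdp_deriv_a ?dvdp_deriv_b//.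
    by rewrite coprimep_expl// coprimep_expr// coprimep_XsubC root_XsubC eq_sym.
- rewrite -[RHS]z0a; apply/matrixP => i j.
  by rewrite !mxE hornerD !hornerM eaa eba mul1r mul0r addr0.
- rewrite -[RHS]z1b; apply/matrixP => i j.
  by rewrite !mxE hornerD !hornerM eab ebb mul1r mul0r add0r.
Qed.

(** A flat interpolation satisfies the controlled equation up to a disturbance
    that can be absorbed by a [y] vanishing at both ends. *)
Lemma polynomial_control p (B : 'M[R]_(n, p)) L (a b : R) (x0 xf : 'cV[R]_n) :
  a != b -> kalman_decomposition A B L ->
  exists (x : 'cV[{poly R}]_n) (u : 'cV[{poly R}]_p),
    [/\ D x = lift A *m x + lift B *m u,
        map_mx (horner^~ a) x = x0 & map_mx (horner^~ b) x = xf].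
Proof.
move=> neq_ab /disturbance ctrl.
have [z [/ctrl[y [u [dy y_ab]]] za zb]] := flat_interpolation L x0 xf neq_ab.
exists (z - y), (- u); split.
- rewrite (map_mxB (@deriv R)) dy mulmxBr mulmxN.
  move: (lift A *m z) (lift A *m y) (lift B *m u) => az ay bu.
  by apply/matrixP => i j; rewrite !mxE; ring.
- rewrite -[RHS]za; apply/matrixP => i j; rewrite !mxE hornerD hornerN.
  have /dvdp_trans/(_ (y_ab i j)) := dvdp_mulIl ('X - a%:P) ('X - b%:P).
  by move/polyXsubCP=> ->; rewrite subr0.
- rewrite -[RHS]zb; apply/matrixP => i j; rewrite !mxE hornerD hornerN.
  have /dvdp_trans/(_ (y_ab i j)) := dvdp_mulIr ('X - a%:P) ('X - b%:P).
  by move/polyXsubCP=> ->; rewrite subr0.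
Qed.

End PolynomialTrajectories.

(** * From the Hautus condition to the Kalman decomposition *)

(** By Cayley-Hamilton, [w *m q(A) *m B = 0] for all polynomials [q], and
    [w *m chi(A) = 0] for the characteristic polynomial [chi].  Multiply [w] by
    the linear factors of [chi] one after the other: if [w] is not 0, then the
    last nonzero product is a left eigenvector killed by [B]. *)
Lemma hautus_observable (F : closedFieldType) n p (A : 'M[F]_n.+1)
    (B : 'M[F]_(n.+1, p)) (w : 'rV[F]_n.+1) :
  hautus A B -> (forall k, (k < n.+1)%N -> w *m (A ^+ k *m B) = 0) -> w = 0.
Proof.
move=> AB wB.
have {wB} wB (q : {poly F}) : w *m horner_mx A q *m B = 0.
  have chi_neq0 : char_poly A != 0 by rewrite monic_neq0 ?char_poly_monic.
  rewrite (divp_eq q (char_poly A)) rmorphD rmorphM /=.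
  rewrite Cayley_Hamilton mulr0 add0r.
  set r := q %% _; have szr : (size r <= n.+1)%N.
    by rewrite -ltnS -(size_char_poly A) ltn_modp.
  rewrite -[r]coefK poly_def raddf_sum mulmx_sumr mulmx_suml big1// => i _.
  rewrite /= linearZ rmorphXn /= horner_mx_X -scalemxAr -scalemxAl -mulmxA.
  rewrite wB ?scaler0//.
  exact: leq_trans (ltn_ord i) szr.
have [s] := closed_field_poly_normal (char_poly A).
rewrite (monicP (char_poly_monic A)) scale1r => chiE.
have : w *m horner_mx A (\prod_(z <- s) ('X - z%:P)) = 0.
  by rewrite -chiE Cayley_Hamilton mulmx0.
elim: s w wB {chiE} => [|z s IH] w wB; first by rewrite big_nil rmorph1 mulmx1.
rewrite big_cons rmorphM mulmxA => /IH wz0.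
apply: (AB z w); last by have := wB 1; rewrite rmorph1 mulmx1.
apply/eqP; rewrite -subr_eq0 -mul_mx_scalar -mulmxBr.
rewrite -[A in A - _]horner_mx_X -(horner_mx_C A z) -rmorphB; apply/eqP/wz0 => q.
by have := wB (('X - z%:P) * q); rewrite rmorphM mulmxA.
Qed.

(** If the columns of the [A ^+ k *m B] did not span the space, a real row
    vector orthogonal to all of them would contradict [hautus_observable] over the
    complex numbers. *)
Lemma hautus_kalman (R : rcfType) n p (A : 'M[R]_n) (B : 'M[R]_(n, p)) :
  hautus (map_mx (real_complex R) A) (map_mx (real_complex R) B) ->
  kalman_decomposition A B n.
Proof.
case: n A B => [|n] A B AB.
  by exists (fun=> 0); rewrite [LHS]flatmx0 [RHS]flatmx0.
pose S := (\sum_(k < n.+1) <<(A ^+ k *m B)^T>>)%MS.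
have full : row_full S.
  rewrite -cokermx_eq0 -trmx_eq0; apply/eqP/row_matrixP => i; rewrite row0.
  apply: (@map_mx_inj _ _ (real_complex R)); rewrite map_mx0.
  apply: hautus_observable AB _ => k ltkn.
  rewrite -(rmorphXn (map_mx (real_complex R))) -!map_mxM.
  apply/eqP; rewrite map_mx_eq0; apply/eqP.
  have /submxP[X XE] : ((A ^+ k *m B)^T <= S)%MS.
    by rewrite -genmxE; exact: (sumsmx_sup (Ordinal ltkn)).
  rewrite -row_mul -[A ^+ k *m B]trmxK -trmx_mul XE -mulmxA mulmx_coker mulmx0.
  by rewrite trmx0 row0.
have /sub_sumsmxP[U UE] : (1%:M <= S)%MS by rewrite sub1mx.
have /fin_all_exists[X XE] (k : 'I_n.+1) :
    exists X, <<(A ^+ k *m B)^T>>%MS = X *m (A ^+ k *m B)^T.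
  by apply/submxP; rewrite genmxE.
exists (fun k => (U k *m X k)^T); apply: trmx_inj.
rewrite trmx1 UE raddf_sum; apply: eq_bigr => k _.
by rewrite /= trmx_mul trmxK XE mulmxA.
Qed.

(** * The Hautus test for trajectories *)

Section Trajectories.
Local Open Scope classical_set_scope.
Local Open Scope ring_scope.
Variable R : realType.
Local Notation mu := (@lebesgue_measure R).

Lemma within_continuous_integrable (a b : R) (f : R -> R) :
  {within `[a, b]%classic, continuous f} ->
  mu.-integrable `[a, b]%classic (EFin \o f).
Proof.
by move=> cf; apply: continuous_compact_integrable => //; exact: segment_compact.
Qed.

Lemma horner_integrable (a b : R) (q : {poly R}) :
  mu.-integrable `[a, b]%classic (EFin \o horner q).
Proof.
by apply/within_continuous_integrable/continuous_subspaceT/continuous_horner.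
Qed.

Lemma Rintegral_deriv (a b : R) (q : {poly R}) : a <= b ->
  \int[mu]_(s in `[a, b]%classic) q^`().[s] = q.[b] - q.[a].
Proof.
rewrite le_eqVlt => /predU1P[->|ltab].
  by rewrite set_itv1 Rintegral_set1 subrr.
rewrite /Rintegral (@continuous_FTC2 _ _ (horner q))//.
- exact/continuous_subspaceT/continuous_horner.
- split; first by move=> x _; exact: derivable_horner.
  + exact/cvg_at_right_filter/continuous_horner.
  + exact/cvg_at_left_filter/continuous_horner.
- by move=> x _; rewrite derivE.
Qed.

Lemma Rintegral_sum d (T : measurableType d) (nu : {measure set T -> \bar R})
    (D : set T) (I : Type) (s : seq I) (f : I -> T -> R) :
  measurable D ->
  (forall i, nu.-integrable D (EFin \o f i)) ->
  \int[nu]_(x in D) (\sum_(i <- s) f i x) =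
  \sum_(i <- s) \int[nu]_(x in D) f i x.
Proof.
move=> mD fi; elim: s => [|i s IH].
  under eq_Rintegral do rewrite big_nil.
  by rewrite big_nil Rintegral_cst// mul0r.
under eq_Rintegral do rewrite big_cons.
rewrite big_cons RintegralD ?IH//.
have := integrable_sum mD s (fun i (_ : xpredT i) => fi i).
by congr (integrable _ _ _); apply/funext => x /=; rewrite sumEFin.
Qed.

Lemma within_continuous_sum (D : set R) (I : Type) (s : seq I)
    (f : I -> R -> R) :
  (forall i, {within D, continuous (f i)}) ->
  {within D, continuous (fun t => \sum_(i <- s) f i t)}.
Proof.
move=> cf; apply: continuous_big => [z|i _]; last exact: cf.
by apply: cvgD; [exact: cvg_fst|exact: cvg_snd].
Qed.

Lemma within_continuous_mulmx r n (D : set R) (W : 'M[R]_(r, n))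
    (y : R -> 'cV[R]_n) k :
  (forall j, {within D, continuous (fun s => y s j ord0)}) ->
  {within D, continuous (fun s => (W *m y s) k ord0)}.
Proof.
move=> cy; under eq_fun do rewrite mxE.
by apply: within_continuous_sum => j x; apply: cvgM; [exact: cvg_cst|exact: cy].
Qed.

Lemma normr_Rintegral_le (a b K : R) (f : R -> R) : a <= b ->
  mu.-integrable `[a, b]%classic (EFin \o f) ->
  (forall s, a <= s <= b -> `|f s| <= K) ->
  `|\int[mu]_(s in `[a, b]%classic) f s| <= K * (b - a).
Proof.
move=> leab fi fK.
have mD : measurable (`[a, b]%classic : set (measurableTypeR R)) by [].
apply: le_trans (le_normr_Rintegral mD fi) _.
have -> : K * (b - a) = \int[mu]_(s in `[a, b]%classic) K.
  rewrite Rintegral_cst//= lebesgue_measure_itv/= lte_fin.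
  by case: ltgtP leab => // -> _; rewrite subrr.
apply: le_Rintegral => //.
- exact: integrable_abse fi.
- by apply/within_continuous_integrable/continuous_subspaceT => x; exact: cvg_cst.
Qed.

(** On an interval so short that the length times the norm of [F] is less than 1,
    the maximum of the norm of a solution is at most a constant less than 1 times
    itself. *)
Lemma integral_equation_eq0 r (F : 'M[R]_r) (a b : R) (y : R -> 'cV[R]_r) :
  a <= b -> (\sum_i \sum_j `|F i j|) * (b - a) < 1 ->
  (forall k, {within `[a, b]%classic, continuous (fun s => y s k ord0)}) ->
  (forall k t, a <= t <= b ->
     y t k ord0 = \int[mu]_(s in `[a, t]%classic) (F *m y s) k ord0) ->
  y b = 0.
Proof.
move=> leab; set c := \sum_i _ => cT cy yE.
pose g s := \sum_k `|y s k ord0|.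
have cg : {within `[a, b]%classic, continuous g}.
  by apply: within_continuous_sum => k x; apply: cvg_norm; exact: cy.
have [t] := EVT_max leab cg; rewrite in_itv/= => /andP[at_ tb] gt.
have yg s k : `|y s k ord0| <= g s.
  by rewrite /g (bigD1 k)//= lerDl sumr_ge0.
have gM s : a <= s <= b -> g s <= g t by move=> hs; apply: gt; rewrite in_itv.
have g_le : g t <= c * (b - a) * g t.
  rewrite {1}/g /c mulr_suml mulr_suml; apply: ler_sum => j _.
  rewrite yE ?at_//.
  apply: (@le_trans _ _ ((\sum_k `|F j k| * g t) * (t - a))).
    apply: normr_Rintegral_le => //.
      apply/within_continuous_integrable/within_continuous_mulmx => k.
      by apply: continuous_subspaceW (cy k); apply: subset_itvl; rewrite bnd_simp.
    move=> s /andP[as_ st]; rewrite mxE; apply: le_trans (ler_norm_sum _ _ _) _.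
    apply: ler_sum => k _; rewrite normrM ler_wpM2l//.
    by rewrite (le_trans (yg _ _))// gM// as_ (le_trans st).
  rewrite -mulr_suml mulrAC ler_wpM2r ?sumr_ge0//.
  by rewrite ler_wpM2l ?sumr_ge0// lerB.
have gt0 : g t = 0.
  apply/eqP; rewrite eq_le [X in _ && X]sumr_ge0// andbT.
  rewrite -(@pmulr_rle0 _ (1 - c * (b - a))) ?subr_gt0//.
  by rewrite mulrBl mul1r subr_le0.
apply/matrixP => k j; rewrite ord1 mxE; apply/eqP; rewrite -normr_le0 -gt0.
by rewrite (le_trans (yg _ _))// gM// leab lexx.
Qed.

Lemma kalman_controllable n p (A : 'M[R]_n) (B : 'M[R]_(n, p)) L :
  kalman_decomposition A B L -> controllable A B.
Proof.
move=> AB t0 tf x0 xf lt_t0f.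
have [x [u [dx xt0 xtf]]] := polynomial_control x0 xf (negbT (lt_eqF lt_t0f)) AB.
exists (fun s => map_mx (horner^~ s) u), (fun s => map_mx (horner^~ s) x).
split=> // k.
  have := @horner_integrable t0 tf (u k ord0).
  by congr (integrable _ _ (_ \o _)); apply/funext => s; rewrite mxE.
have xk : (fun s => (x ^ horner^~ s)%sesqui k ord0) = horner (x k ord0).
  by apply/funext => s; rewrite mxE.
split; first by rewrite xk; exact/continuous_subspaceT/continuous_horner.
move=> t /andP[t0t _]; rewrite !mxE -[LHS](subrK (x k ord0).[t0]) addrC.
congr (_ + _); rewrite -Rintegral_deriv//; apply: eq_Rintegral => s _.
have := congr1 (fun z : 'cV[{poly R}]_n => (z k ord0).[s]) dx.
rewrite !mxE hornerD !horner_sum => ->.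
by congr (_ + _); apply: eq_bigr => l _; rewrite !mxE hornerM hornerC.
Qed.

Lemma Rintegral_mulmx d (T : measurableType d) (nu : {measure set T -> \bar R})
    (D : set T) r n (W : 'M[R]_(r, n)) (y : T -> 'cV[R]_n) k :
  measurable D ->
  (forall j, nu.-integrable D (EFin \o (fun s => y s j ord0))) ->
  nu.-integrable D (EFin \o (fun s => (W *m y s) k ord0)) /\
  \int[nu]_(s in D) (W *m y s) k ord0 =
  \sum_j W k j * \int[nu]_(s in D) y s j ord0.
Proof.
move=> mD yi.
have Wyi j : nu.-integrable D (EFin \o (fun s => W k j * y s j ord0)).
  have := integrableZl mD (W k j) (yi j).
  by congr (integrable _ _ _); apply/funext => s /=; rewrite EFinM.
split.
  have := integrable_sum mD (index_enum 'I_n) (fun j (_ : xpredT j) => Wyi j).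
  by congr (integrable _ _ _); apply/funext => s /=; rewrite mxE sumEFin.
under eq_Rintegral do rewrite mxE.
by rewrite Rintegral_sum//; apply: eq_bigr => j _; rewrite RintegralZl.
Qed.

(** [W *m x] solves an autonomous linear equation and stays at 0 when it starts
    there, while [x] can reach any state: hence [W = 0].  Controllability is used
    on an interval short enough for [integral_equation_eq0]. *)
Lemma controllable_intertwine r n p (A : 'M[R]_n) (B : 'M[R]_(n, p))
    (W : 'M[R]_(r, n)) (F : 'M[R]_r) :
  controllable A B -> W *m A = F *m W -> W *m B = 0 -> W = 0.
Proof.
move=> AB WA WB.
suff W0 (z : 'cV[R]_n) : W *m z = 0.
  apply/matrixP => i j.
  have := congr1 (fun M : 'cV[R]_r => M i ord0) (W0 (delta_mx j ord0)).
  by rewrite -colE !mxE.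
pose c := \sum_i \sum_j `|F i j|.
have c_ge0 : 0 <= c by apply: sumr_ge0 => i _; exact: sumr_ge0.
pose h := (c + 1)^-1.
have h_gt0 : 0 < h by rewrite invr_gt0 ltr_wpDl.
have ch : c * (h - 0) < 1.
  by rewrite subr0 ltr_pdivrMr ?ltr_wpDl// mul1r ltrDl.
have [u [x [u_adm xu x0 <-]]] := AB 0 h 0 z h_gt0.
apply: (integral_equation_eq0 (F := F) (y := fun s => W *m x s) (ltW h_gt0) ch) => k.
  by apply: within_continuous_mulmx => j; case: (xu j).
move=> t /andP[t_ge0 t_leh].
have mD : measurable (`[0, t]%classic : set (measurableTypeR R)) by [].
have xi j : mu.-integrable `[0, t]%classic (EFin \o (fun s => x s j ord0)).
  apply: within_continuous_integrable; have [xc _] := xu j.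
  by apply: continuous_subspaceW xc; apply: subset_itvl; rewrite bnd_simp.
have ui j : mu.-integrable `[0, t]%classic (EFin \o (fun s => u s j ord0)).
  apply: integrableS (u_adm j) => //.
  by apply: subset_itvl; rewrite bnd_simp.
have fi j : mu.-integrable `[0, t]%classic
    (EFin \o (fun s => (A *m x s + B *m u s) j ord0)).
  have [Axi _] := Rintegral_mulmx A j mD xi.
  have [Bui _] := Rintegral_mulmx B j mD ui.
  have := integrableD mD Axi Bui.
  by congr (integrable _ _ _); apply/funext => s /=; rewrite [in RHS]mxE EFinD.
have [_ WE] := Rintegral_mulmx W k mD fi.
have -> : (W *m x t) k ord0 =
    \int[mu]_(s in `[0, t]%classic) (W *m (A *m x s + B *m u s)) k ord0.
  rewrite WE mxE; apply: eq_bigr => j _; have [_ ->] := xu j; last by rewrite t_ge0.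
  by rewrite x0 mxE add0r.
by apply: eq_Rintegral => s _; rewrite mulmxDr !mulmxA WA WB mul0mx addr0.
Qed.

Lemma map_Re_mulmx r n q (V : 'M[complex R]_(r, n)) (M : 'M[R]_(n, q)) :
  map_mx (@complex.Re R) (V *m map_mx (real_complex R) M) =
  map_mx (@complex.Re R) V *m M.
Proof.
apply/matrixP => i j; rewrite !mxE raddf_sum; apply: eq_bigr => k _.
by rewrite !mxE; case: (V i k) => a b /=; rewrite mulr0 subr0.
Qed.

Lemma map_Im_mulmx r n q (V : 'M[complex R]_(r, n)) (M : 'M[R]_(n, q)) :
  map_mx (@complex.Im R) (V *m map_mx (real_complex R) M) =
  map_mx (@complex.Im R) V *m M.
Proof.
apply/matrixP => i j; rewrite !mxE raddf_sum; apply: eq_bigr => k _.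
by rewrite !mxE; case: (V i k) => a b /=; rewrite mulr0 add0r.
Qed.

(** An eigenvalue [a + i b] acts on the rows (Re v, Im v) as the real matrix with
    rows (a, - b) and (b, a). *)
Lemma controllable_hautus n p (A : 'M[R]_n) (B : 'M[R]_(n, p)) :
  controllable A B -> hautus (complexify A) (map_mx (real_complex R) B).
Proof.
move=> AB [a b] v vA vB.
pose W := col_mx (map_mx (@complex.Re R) v) (map_mx (@complex.Im R) v).
pose F : 'M[R]_(1 + 1) := block_mx a%:M (- b%:M) b%:M a%:M.
have W0 : W = 0.
  apply: (controllable_intertwine (F := F) AB).
    rewrite /W /F mul_col_mx mul_block_col -map_Re_mulmx -map_Im_mulmx vA.
    rewrite mulNmx !mul_scalar_mx.
    congr col_mx; apply/matrixP => i j; rewrite !mxE /=.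
      by case: (v i j).
    by case: (v i j) => x y /=; rewrite addrC.
  rewrite /W mul_col_mx -map_Re_mulmx -map_Im_mulmx vB -col_mx0.
  by congr col_mx; apply/matrixP => i j; rewrite !mxE.
have /eqP := W0; rewrite col_mx_eq0 => /andP[/eqP re0 /eqP im0].
apply/matrixP => i j; rewrite mxE; apply/eqP; rewrite eq_complex.
have := congr1 (fun M : 'rV[R]_n => M i j) re0.
have := congr1 (fun M : 'rV[R]_n => M i j) im0.
by rewrite !mxE => -> ->; rewrite eqxx.
Qed.

Lemma controllableP n p (A : 'M[R]_n) (B : 'M[R]_(n, p)) :
  controllable A B <-> hautus (complexify A) (map_mx (real_complex R) B).
Proof.
split; first exact: controllable_hautus.
by move=> /hautus_kalman/kalman_controllable.
Qed.

End Trajectories.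

(** * Left eigenvectors of the network *)

Lemma map_mxblock (aT rT : Type) (f : aT -> rT) m n (p_ : 'I_m -> nat)
    (q_ : 'I_n -> nat) (M : forall i j, 'M[aT]_(p_ i, q_ j)) :
  map_mx f (\mxblock_(i, j) M i j) = \mxblock_(i, j) map_mx f (M i j).
Proof. by apply/matrixP => i j; rewrite !mxE. Qed.

Section Blocks.
Variables (R : realType) (N m : nat) (n p : 'I_N -> nat).
Variables (A : forall i : 'I_N, 'M[R]_(n i)).
Variables (B : forall i : 'I_N, 'M[R]_(n i, p i)).
Variables (C : forall i : 'I_N, 'M[R]_(m, n i)).
Variables (H : forall i : 'I_N, 'M[R]_(n i, m)).
Variables (delta : 'I_N -> bool) (beta : 'I_N -> 'I_N -> R).
Local Notation lift := (map_mx (real_complex R)).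

Definition coupling i j : 'M[complex R]_(n i, n j) :=
  lift (beta i j *: (H i *m C j)).

Lemma mulmx_network_state (v : forall i, 'rV[complex R]_(n i)) :
  \mxrow_i v i *m complexify (network_state A C H beta) =
  \mxrow_j (v j *m complexify (A j) + \sum_i v i *m coupling i j).
Proof.
have liftA : lift (\mxdiag_i A i) = \mxdiag_i lift (A i).
  rewrite /mxdiag map_mxblock; apply: eq_mxblock => i j.
  by case: eqP => [<-|_]; rewrite ?map_conform_mx ?map_mx0 ?conform_mx_id.
rewrite /complexify map_mxD liftA mulmxDr mul_mxrow_mxdiag map_mxblock.
by rewrite mul_mxrow_mxblock -mxrowD.
Qed.

Lemma mulmx_network_input (v : forall i, 'rV[complex R]_(n i)) :
  \mxrow_i v i *m lift (network_input B delta) =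
  \mxrow_j (v j *m lift ((delta j)%:R *: B j)).
Proof.
rewrite map_mxblock mul_mxrow_mxblock; apply: eq_mxrow => j.
rewrite (bigD1 j)//= eqxx conform_mx_id big1 ?addr0// => i /negPf ij.
by rewrite ij map_mx0 mulmx0.
Qed.

Lemma eigen_network_state (a : complex R) (v : forall i, 'rV[complex R]_(n i)) :
  \mxrow_i v i *m complexify (network_state A C H beta) = a *: \mxrow_i v i <->
  forall j, v j *m complexify (A j) + \sum_i v i *m coupling i j = a *: v j.
Proof.
rewrite mulmx_network_state (_ : a *: _ = \mxrow_j (a *: v j)) -?eq_mxrowP//.
by apply/matrixP => i j; rewrite !mxE.
Qed.

(** If left eigenvectors do not see the coupling, then neither does the Hautus
    test.  An eigenvector of one node, extended by 0, is one of the network. *)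
Lemma hautus_network :
  (forall (a : complex R) (v : forall i, 'rV[complex R]_(n i)),
    \mxrow_i v i *m complexify (network_state A C H beta) = a *: \mxrow_i v i <->
    forall i, v i *m complexify (A i) = a *: v i) ->
  hautus (complexify (network_state A C H beta)) (lift (network_input B delta)) <->
  forall i, hautus (complexify (A i)) (lift ((delta i)%:R *: B i)).
Proof.
move=> decoupled; split=> [net i a v vA vB|nodes a v].
  pose w j : 'rV[complex R]_(n j) := if i == j then conform_mx 0 v else 0.
  have wi : w i = v by rewrite /w eqxx conform_mx_id.
  have wN j : i != j -> w j = 0 by rewrite /w => /negPf->.
  suff w0 : \mxrow_j w j = 0 by rewrite -wi -[w i](mxrowK w) w0 submxrow0.
  apply: (net a).
    apply/decoupled => j; have [<-|/wN->] := eqVneq i j; first by rewrite wi.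
    by rewrite mul0mx scaler0.
  rewrite mulmx_network_input -mxrow0; apply: eq_mxrow => j.
  by have [<-|/wN->] := eqVneq i j; rewrite ?wi ?vB ?mul0mx.
rewrite -[v]submxrowK => /decoupled vA.
rewrite mulmx_network_input -mxrow0 => /eq_mxrowP vB.
by rewrite -mxrow0; apply: eq_mxrow => i; exact: nodes (vA i) (vB i).
Qed.

End Blocks.

Section Cycle.
Variables (R : realType) (N m : nat) (n : 'I_N -> nat).
Variables (A : forall i : 'I_N, 'M[R]_(n i)).
Variables (C : forall i : 'I_N, 'M[R]_(m, n i)).
Variables (H : forall i : 'I_N, 'M[R]_(n i, m)).
Variables (beta : 'I_N -> 'I_N -> R).
Local Notation lift := (map_mx (real_complex R)).

(** Row 0 is the only row of the state matrix with an off-diagonal block, and that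
    block lies in the last column.  So column 0 of the eigenvector equation is the
    equation of node 0 alone, and its solution annihilates the block. *)
Lemma cycle_eigenvectors :
  (1 < N)%N -> cycle_topology beta ->
  (forall i j : 'I_N, val i = (val j).+1 -> H i *m C j = 0) ->
  (forall i l : 'I_N, val i = 0%N -> val l = N.-1 ->
     forall (a : complex R) (v : 'rV_(n i)),
     v *m complexify (A i) = a *: v -> v *m lift (H i *m C l) = 0) ->
  forall (a : complex R) (v : forall i, 'rV[complex R]_(n i)),
    \mxrow_i v i *m complexify (network_state A C H beta) = a *: \mxrow_i v i <->
    forall i, v i *m complexify (A i) = a *: v i.
Proof.
move=> N_gt1 cyc HC0 vHC0 a v; rewrite eigen_network_state.
have coupling0 i j : (val i == 0%N) && (val j == N.-1) = false ->
    coupling C H beta i j = 0.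
  rewrite /coupling => notlast; have [->|] := eqVneq (beta i j) 0.
    by rewrite scale0r map_mx0.
  by rewrite cyc notlast orbF => /eqP/HC0->; rewrite scaler0 map_mx0.
have coupling_eigen i j : (val i = 0%N -> v i *m complexify (A i) = a *: v i) ->
    v i *m coupling C H beta i j = 0.
  have [|/negbTE/coupling0->] := boolP ((val i == 0%N) && (val j == N.-1));
    last by rewrite mulmx0.
  case/andP=> /eqP i0 /eqP jN /(_ i0)/(vHC0 _ _ i0 jN) vHC.
  by rewrite /coupling map_mxZ -scalemxAr vHC scaler0.
split=> [vE|vA i]; last first.
  by rewrite big1 ?addr0 ?vA// => j _; apply: coupling_eigen => _; exact: vA.
have vA0 i : val i = 0%N -> v i *m complexify (A i) = a *: v i.
  move=> i0; rewrite -vE big1 ?addr0// => j _; rewrite coupling0 ?mulmx0//.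
  by rewrite i0 [0%N == _]ltn_eqF ?andbF// -subn1 subn_gt0.
by move=> i; rewrite -vE big1 ?addr0// => j _; exact/coupling_eigen/vA0.
Qed.

End Cycle.

(** As many independent eigenvectors as the geometric multiplicity span the
    eigenspace, by equality of dimensions. *)
Lemma eigenspace_sub_family (F : fieldType) n (M : 'M[F]_n) (a : F)
    (z : 'I_(\rank (eigenspace M a)) -> 'rV[F]_n) :
  (forall k, z k *m M = a *: z k) -> row_free (\matrix_k z k) ->
  (eigenspace M a <= \matrix_k z k)%MS.
Proof.
move=> zM /eqP rk_z; have z_sub : (\matrix_k z k <= eigenspace M a)%MS.
  by apply/row_subP => k; rewrite rowK; apply/eigenspaceP.
by rewrite -(mxrank_leqif_sup z_sub) rk_z.
Qed.

Theorem corollaryA2 (R : realType) (N m : nat) (n p : 'I_N -> nat)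
  (A : forall i : 'I_N, 'M[R]_(n i))
  (B : forall i : 'I_N, 'M[R]_(n i, p i))
  (C : forall i : 'I_N, 'M[R]_(m, n i))
  (H : forall i : 'I_N, 'M[R]_(n i, m))
  (delta : 'I_N -> bool) (beta : 'I_N -> 'I_N -> R)
  (q : 'I_N -> nat)
  (mu : forall i : 'I_N, 'I_(q i) -> complex R)
  (zeta : forall (i : 'I_N) (j : 'I_(q i)),
     'I_(geometric_multiplicity (complexify (A i)) (mu i j)) ->
     'rV[complex R]_(n i))
  (N_gt1 : (1 < N)%N)
  (n_gt0 : forall i : 'I_N, (0 < n i)%N)
  (beta_cycle : cycle_topology beta)
  (mu_distinct : forall i : 'I_N, injective (mu i))
  (mu_spectrum : forall (i : 'I_N) (a : complex R),
     eigenvalue (complexify (A i)) a <-> exists j : 'I_(q i), mu i j = a)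
  (zeta_eigen : forall i j k,
     left_eigenvector (complexify (A i)) (mu i j) (zeta i j k))
  (zeta_indep : forall i j, row_free (\matrix_k zeta i j k))
  (HC_eq0 : forall i j : 'I_N, val i = (val j).+1 -> H i *m C j = 0)
  (zetaHC_eq0 : forall i l : 'I_N, val i = 0%N -> val l = N.-1 ->
     forall j k, zeta i j k *m map_mx (real_complex R) (H i *m C l) = 0) :
  controllable (network_state A C H beta) (network_input B delta) <->
  (forall i : 'I_N, controllable (A i) (B i)) /\
  (forall i : 'I_N, delta i).
Proof.
have left_eigen i l : val i = 0%N -> val l = N.-1 ->
    forall (a : complex R) (v : 'rV_(n i)), v *m complexify (A i) = a *: v ->
    v *m map_mx (real_complex R) (H i *m C l) = 0.
  move=> i0 lN a v vA; have [->|v_neq0] := eqVneq v 0; first exact: mul0mx.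
  have /mu_spectrum[j muE] : eigenvalue (complexify (A i)) a.
    by apply/eigenvalueP; exists v.
  rewrite -muE in vA.
  have /submxP[D ->] : (v <= \matrix_k zeta i j k)%MS.
    apply: (submx_trans (introT eigenspaceP vA)).
    apply: eigenspace_sub_family; last exact: zeta_indep.
    by move=> k; case: (zeta_eigen i j k).
  rewrite -mulmxA (_ : _ *m map_mx _ _ = 0) ?mulmx0//.
  by apply/row_matrixP => k; rewrite row_mul rowK row0; exact: zetaHC_eq0.
have decoupled := cycle_eigenvectors N_gt1 beta_cycle HC_eq0 left_eigen.
rewrite controllableP (hautus_network B delta decoupled).
split=> [nodes|[ctrl ctrl_delta] i]; last first.
  by rewrite ctrl_delta scale1r; exact/controllableP.
have all_delta i : delta i.
  apply/negPn/negP => /negPf deltaF.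
  have [a /eigenvalueP[v vA /eqP[]]] :=
    eigenvalue_closed (complexify (A i)) (n_gt0 i).
  by apply: (nodes i a) => //; rewrite deltaF scale0r map_mx0 mulmx0.
split=> // i; apply/controllableP.
by have := nodes i; rewrite all_delta scale1r.
Qed.
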